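(* Let $V$ be an Orlicz function (not necessarily superquadratic, i.e. it is not required that $V(x)/x^2\to\infty$ as $x\to\infty$), and let $\mathbb B_V^n=\{x\in\mathbb R^n:\sum_{i=1}^nV(x_i)\le n\}$, with $n$-dimensional Lebesgue volume $|\mathbb B_V^n|$. Then $$\lim_{n\to\infty}\frac1n\log|\mathbb B_V^n|=-\sup_{s<0}\left\{s-\log\left(\int_{D_V}e^{sV(x)}\,dx\right)\right\}.$$
   Context: An Orlicz function is a convex function $V:\mathbb R\to\mathbb R_+\cup\{\infty\}$ with $V(0)=0$ and $V(x)=V(-x)$ for $x\in\mathbb R$; its domain is $D_V=\{x\in\mathbb R:V(x)<\infty\}$. *)

(* Defs.v *)
From HB Require Import structures.
From mathcomp Require Import all_boot all_order all_algebra.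
From mathcomp Require Import all_classical all_reals all_analysis.

Set Implicit Arguments.
Unset Strict Implicit.
Unset Printing Implicit Defensive.

Import Order.TTheory GRing.Theory Num.Theory.
Import numFieldNormedType.Exports.

Local Open Scope classical_set_scope.
Local Open Scope ring_scope.
Local Open Scope ereal_scope.

(* The convention [0 * +oo = 0] makes the endpoint cases [t = 0] and [t = 1]
   of convexity trivial. *)
Definition orlicz_function (R : realType) (V : R -> \bar R) : Prop :=
  [/\ forall x, 0 <= V x,
      V 0%R = 0,
      forall x, V (- x)%R = V x
    & forall (x y t : R), (0 <= t <= 1)%R ->
        V (t * x + (1 - t) * y)%R <= t%:E * V x + (1 - t)%:E * V y].

Definition orlicz_domain (R : realType) (V : R -> \bar R) : set R :=
  [set x | V x < +oo].

(* Lebesgue measure on R^n, as the n-fold product of the one-dimensional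
   Lebesgue measure: R^0 is a point of mass 1 and R^(n+1) is identified
   with R * R^n. *)
Fixpoint lebesgue_tuple (R : realType) (n : nat) :
    set (n.-tuple R) -> \bar R :=
  match n with
  | 0%N => dirac [tuple]
  | m.+1 => pushforward
      (product_measure1 (@lebesgue_measure R) (@lebesgue_tuple R m))
      (fun p : R * m.-tuple R => [tuple of p.1 :: p.2])
  end.

Definition orlicz_ball (R : realType) (V : R -> \bar R) (n : nat) :
    set (n.-tuple R) :=
  [set x | \sum_(i < n) V (tnth x i) <= n%:R%:E].

Arguments orlicz_ball {R} V n.

(* Main.v *)
Require Import Defs.
From HB Require Import structures.
From mathcomp Require Import all_boot all_order all_algebra.
From mathcomp Require Import all_classical all_reals all_analysis.
From mathcomp Require Import measurable_realfun ring lra.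
Import Order.TTheory GRing.Theory Num.Theory.
Import numFieldNormedType.Exports.
Local Open Scope classical_set_scope.
Local Open Scope ring_scope.
Local Open Scope ereal_scope.

(* Put u := V - 1 on the domain of V, F(s) := \int exp(s u) and
   v_n(t) := |{sum_i V(x_i) <= n + t}|, so that |B_V^n| = v_n(0) and the claim
   is log v_n(0) / n --> inf_{s<0} log F(s).  Cutting along the first coordinate
   gives v_{n+1}(t) = \int v_n(t - u(x)) dx, hence everything reduces to
   one-dimensional integrals.  The Chernoff bound v_n(0) <= F(s)^n holds for all
   s < 0.  Conversely, tilting by exp(s u) and Chebyshev's inequality give
   liminf log v_n(0) / n >= log F(s) - 2 s m(s) whenever the tilted mean
   m(s) = F'(s) / F(s) is negative, and s < 0 can be chosen with m(s) < 0 and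
   s m(s) arbitrarily small: either m vanishes somewhere and s is taken just
   before, or m < 0 near 0 and s tends to 0.  Two degenerate functions are
   treated apart: V = 0, and V = +oo outside 0. *)

(* [ge0_le_integral] and [le_integral] require measurability, which is never
   established for the functions [x |-> v n (t - u x)]. *)
Lemma le_integral_nonmeasurable d (T : measurableType d) (R : realType)
    (mu : {measure set T -> \bar R}) (D : set T) (f g : T -> \bar R) :
  (forall x, D x -> f x <= g x) ->
  \int[mu]_(x in D) f x <= \int[mu]_(x in D) g x.
Proof.
move=> fg; rewrite /integral.
have fgD x : (f \_ D) x <= (g \_ D) x.
  by rewrite /patch; case: ifPn => // /set_mem; exact: fg.
apply: leeB; apply: ereal_sup_le => _ [h hf <-]; exists h => // x;
  apply: (le_trans (hf x)).
- by apply: (@funepos_le _ _ setT) => [y _|]; [exact: fgD|rewrite inE].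
- by apply: (@funeneg_le _ _ setT) => [y _|]; [exact: fgD|rewrite inE].
Qed.

(** * Exponential upper and lower bounds from the one-variable recursion *)

Section sublevel_volume.
Context d (T : measurableType d) (R : realType).
Variables (mu : {measure set T -> \bar R}) (D : set T) (u : T -> R).
Hypothesis mD : measurable D.
Variable v : nat -> R -> \bar R.
Hypothesis v0 : forall t, v 0%N t = ((0 <= t)%R%:R : R)%:E.
Hypothesis vS : forall n t, v n.+1 t = \int[mu]_(x in D) v n (t - u x)%R.

Local Notation "'tilt' s" := (fun x => expR (s * u x))%R (at level 10).

(** By induction: the indicator of [0 <= t] is at most [expR (- s * t)] because [s <= 0], and
    shifting [t] by [u x] multiplies the bound by [expR (s * u x)], which integrates to one more
    factor [F]. *)
Lemma chernoff_upper_bound (s : R) (n : nat) (t : R) : (s <= 0)%R ->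
  mu.-integrable D (EFin \o tilt s) ->
  v n t <= (expR (- s * t) * (\int[mu]_(x in D) tilt s x) ^+ n)%R%:E.
Proof.
move=> s0 intF; elim: n t => [|n IH] t.
  rewrite v0 expr0 mulr1 lee_fin; have [t0|t0] := leP 0%R t; last exact: expR_ge0.
  by rewrite -expR0 ler_expR mulr_ge0// oppr_ge0.
rewrite vS; set F := (\int[mu]_(x in D) _)%R in IH *.
apply: (@le_trans _ _ (\int[mu]_(x in D)
    ((expR (- s * t) * F ^+ n)%R%:E * (expR (s * u x))%:E))).
  apply: le_integral_nonmeasurable => x _; apply: (le_trans (IH _)).
  rewrite -EFinM lee_fin [leRHS]mulrAC -expRD.
  by have -> : (- s * (t - u x) = - s * t + s * u x)%R by ring.
rewrite integralZl//.
rewrite -[X in _ * X]fineK ?integrable_fin_num//.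
by rewrite -EFinM lee_fin -/F exprSr mulrA.
Qed.

(* Under the n-fold product of the tilted measure [exp(s u) / F], whose marginals
   have mean [m] and variance [sg], the last factor is Chebyshev's lower bound for
   the probability that the sum of the [u x_i] lies in the window [[t - 2c, t]];
   being quadratic in [t], it reproduces itself when a variable is integrated out. *)
Lemma chebyshev_lower_bound (s c m sg : R) (n : nat) (t : R) :
  let F := (\int[mu]_(x in D) tilt s x)%R in
  (s < 0)%R -> (0 < c)%R ->
  mu.-integrable D (EFin \o tilt s) ->
  mu.-integrable D (EFin \o (fun x => u x * tilt s x)%R) ->
  mu.-integrable D (EFin \o (fun x => u x ^+ 2 * tilt s x)%R) ->
  (\int[mu]_(x in D) (u x * tilt s x) = F * m)%R ->
  (\int[mu]_(x in D) (u x ^+ 2 * tilt s x) = F * (sg + m ^+ 2))%R ->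
  (F ^+ n * expR (- s * (t - 2 * c)) *
    (1 - (sg * n%:R + (n%:R * m - t + c) ^+ 2) / c ^+ 2))%R%:E <= v n t.
Proof.
move=> F s0 c0 int0 int1 int2 E1 E2.
elim: n t => [|n IH] t.
  (* For [n = 0] the last factor is [1 - ((c - t) / c) ^+ 2]: it never exceeds 1 and is nonpositive
     unless [0 < t < 2 * c], where the exponential is at most 1 since [s < 0]. *)
  rewrite v0 expr0 mul1r mulr0 mul0r !add0r lee_fin.
  have c20 : (0 < c ^+ 2)%R by rewrite exprn_gt0.
  have expp := expR_ge0 (- s * (t - 2 * c))%R.
  have [t0|t0] := leP 0%R t.
    have [tc|tc] := leP t (2 * c)%R; last first.
      rewrite (@le_trans _ _ 0%R)//; apply: mulr_ge0_le0 => //.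
      by rewrite subr_le0 ler_pdivlMr// mul1r; nra.
    apply: mulr_ile1 => //.
    - by rewrite subr_ge0 ler_pdivrMr// mul1r; nra.
    - rewrite -[leRHS]expR0 ler_expR; apply: mulr_ge0_le0.
        by rewrite oppr_ge0 ltW.
      by rewrite subr_le0.
    - by rewrite lerBlDr lerDl divr_ge0 ?sqr_ge0// ltW.
  apply: mulr_ge0_le0 => //.
  by rewrite subr_le0 ler_pdivlMr// mul1r; nra.
rewrite vS.
(* The induction hypothesis at [t - u x] is [expR (s * u x)] times a quadratic polynomial in [u x],
   with coefficients [A], [B], [C]; the three moments integrate it exactly. *)
pose q := (n%:R * m - t + c)%R.
pose K := (F ^+ n * expR (- s * (t - 2 * c)))%R.
pose A := (K * (1 - (sg * n%:R + q ^+ 2) / c ^+ 2))%R.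
pose B := (K * (- (2 * q) / c ^+ 2))%R.
pose C := (K * - (c ^+ 2)^-1)%R.
have intA : mu.-integrable D (EFin \o (fun x => A * tilt s x)%R).
  exact: (integrableZl mD A int0).
have intB : mu.-integrable D (EFin \o (fun x => B * (u x * tilt s x))%R).
  exact: (integrableZl mD B int1).
have intC : mu.-integrable D (EFin \o (fun x => C * (u x ^+ 2 * tilt s x))%R).
  exact: (integrableZl mD C int2).
have intAB : mu.-integrable D
    (EFin \o (fun x => A * tilt s x + B * (u x * tilt s x))%R).
  exact: (integrableD mD intA intB).
have intABC : mu.-integrable D (EFin \o
    (fun x => A * tilt s x + B * (u x * tilt s x) + C * (u x ^+ 2 * tilt s x))%R).
  exact: (integrableD mD intAB intC).
have c2 : (c != 0)%R by rewrite gt_eqF.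
apply: (@le_trans _ _ (\int[mu]_(x in D)
    (A * tilt s x + B * (u x * tilt s x) + C * (u x ^+ 2 * tilt s x))%R%:E)).
  rewrite -[leRHS]fineK ?(integrable_fin_num _ intABC)// lee_fin.
  rewrite -/(Rintegral mu D _) RintegralD// RintegralD// !RintegralZl//.
  rewrite E1 E2 -/F le_eqVlt; apply/orP; left; apply/eqP.
  rewrite /A /B /C /K /q exprS -natr1; field.
  exact: c2.
apply: le_integral_nonmeasurable => x _; apply: le_trans (IH _).
rewrite lee_fin le_eqVlt; apply/orP; left; apply/eqP.
have -> : expR (- s * (t - u x - 2 * c)) =
    (expR (- s * (t - 2 * c)) * expR (s * u x))%R.
  by rewrite -expRD; congr expR; ring.
by rewrite /A /B /C /K /q; field.
Qed.

End sublevel_volume.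

(** * Moments of the tilted measure and choice of the tilting parameter *)

Section tilted_moments.
Context d (T : measurableType d) (R : realType).
Variables (mu : {measure set T -> \bar R}) (D A : set T) (u : T -> R).
Hypothesis mD : measurable D.
Hypothesis mfu : measurable_fun D u.
Hypothesis u_ge : forall x, D x -> (-1 <= u x)%R.
Hypothesis int0 : forall s : R, (s < 0)%R ->
  mu.-integrable D (EFin \o (fun x => expR (s * u x))%R).
Hypothesis mA : measurable A.
Hypothesis AD : A `<=` D.
Hypothesis A_gt0 : 0 < mu A.
Hypothesis A_fin : mu A < +oo.
Hypothesis uA : forall x, A x -> (u x <= - 2^-1)%R.

Local Notation F := (fun s => \int[mu]_(x in D) expR (s * u x))%R.
Local Notation G := (fun s => \int[mu]_(x in D) (u x * expR (s * u x)))%R.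

(** Half of the exponent absorbs the square: [u ^+ 2 * expR (s / 2 * u)] is bounded on [D], and the
    remaining factor [expR (s / 2 * u)] is integrable. *)
Lemma integrable_sqr_tilt (s : R) : (s < 0)%R ->
  mu.-integrable D (EFin \o (fun x => u x ^+ 2 * expR (s * u x))%R).
Proof.
move=> s0; pose e := (- (s / 2))%R.
have e0 : (0 < e)%R by rewrite /e; lra.
apply: (@le_integrable _ _ _ _ _ mD _
  (fun x => (2 / e ^+ 2 * expR (2 * e))%:E * (expR (s / 2 * u x))%:E)).
- apply/measurable_EFinP; apply: measurable_funM.
    exact: measurable_funX.
  by apply: measurableT_comp => //; exact: measurable_funM.
- move=> x Dx /=; rewrite lee_fin.
  rewrite ger0_norm; last by apply: mulr_ge0; rewrite ?sqr_ge0 ?expR_ge0.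
  rewrite ger0_norm; last first.
    by rewrite !mulr_ge0 ?expR_ge0 ?invr_ge0 ?sqr_ge0.
  have -> : (s * u x = - (e * u x) + s / 2 * u x)%R by rewrite /e; field.
  rewrite expRD mulrA ler_wpM2r ?expR_ge0//.
  have ux := u_ge x Dx.
  (* Since [u x >= -1], the shifted value [u x + 2] is nonnegative and dominates the absolute value
     of [u x], so that [y ^+ 2 <= 2 * expR y] for [y >= 0] can be used. *)
  have y0 : (0 <= e * (u x + 2))%R by rewrite mulr_ge0 ?ltW//; lra.
  have := @expR_ge1Dxn R (e * (u x + 2)) 1 y0.
  rewrite (_ : 2`! = 2)%N // => h.
  have {}h : ((e * u x) ^+ 2 <= 2 * expR (e * (u x + 2)))%R.
    have : (0 <= (e * e) * (4 * u x + 4))%R.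
      by apply: mulr_ge0; [rewrite mulr_ge0 ?ltW|lra].
    have -> : ((e * e) * (4 * u x + 4) =
               (e * (u x + 2)) ^+ 2 - (e * u x) ^+ 2)%R by ring.
    lra.
  rewrite expRN ler_pdivrMr ?expR_gt0//.
  have -> : (2 / e ^+ 2 * expR (2 * e) * expR (e * u x) =
             2 * expR (e * (u x + 2)) / e ^+ 2)%R.
    have -> : (e * (u x + 2) = 2 * e + e * u x)%R by ring.
    by rewrite expRD; ring.
  by rewrite ler_pdivlMr ?exprn_gt0// mulrC -exprMn.
- have s2 : (s / 2 < 0)%R by lra.
  exact: (integrableZl mD (2 / e ^+ 2 * expR (2 * e))%R (int0 _ s2)).
Qed.

Lemma integrable_id_tilt (s : R) : (s < 0)%R ->
  mu.-integrable D (EFin \o (fun x => u x * expR (s * u x))%R).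
Proof.
move=> s0.
apply: (@le_integrable _ _ _ _ _ mD _ (EFin \o
  (fun x => expR (s * u x) + u x ^+ 2 * expR (s * u x))%R)).
- apply/measurable_EFinP; apply: measurable_funM => //.
  by apply: measurableT_comp => //; exact: measurable_funM.
- move=> x Dx /=; rewrite lee_fin.
  rewrite normrM [X in (_ * X)%R]ger0_norm ?expR_ge0//.
  rewrite [leRHS]ger0_norm; last first.
    by rewrite addr_ge0 ?expR_ge0//; apply: mulr_ge0; rewrite ?sqr_ge0 ?expR_ge0.
  rewrite -[X in (X + _)%R]mul1r -mulrDl ler_wpM2r ?expR_ge0//.
  rewrite ler_norml; apply/andP; split; nra.
- exact: (integrableD mD (int0 s s0) (integrable_sqr_tilt s s0)).
Qed.

(** On [A], [expR (s * u x) >= 1 + s * u x >= 1 - s / 2]. This keeps [F] away from 0 and makes it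
    grow at least linearly as [s] tends to [-oo]. *)
Lemma tilted_mass_ge (s : R) : (s < 0)%R ->
  ((1 - s / 2) * fine (mu A) <= F s)%R.
Proof.
move=> s0; rewrite -lee_fin fineK ?(integrable_fin_num mD (int0 s s0))//.
rewrite EFinM fineK ?ge0_fin_numE//.
rewrite -(integral_cst mu mA).
apply: (@le_trans _ _ (\int[mu]_(x in A) (expR (s * u x))%:E)).
  apply: le_integral_nonmeasurable => x Ax; rewrite lee_fin.
  have ux := uA x Ax.
  by apply: le_trans (expR_ge1Dx _); nra.
apply: ge0_subset_integral => //.
exact: measurable_int (int0 s s0).
Qed.

Lemma fine_muA_gt0 : (0 < fine (mu A))%R.
Proof. by rewrite fine_gt0// A_gt0. Qed.

Lemma tilted_mass_gt0 (s : R) : (s < 0)%R -> (0 < F s)%R.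
Proof.
move=> s0; apply: lt_le_trans (tilted_mass_ge s s0).
by rewrite mulr_gt0 ?fine_muA_gt0//; lra.
Qed.

(** Convexity of [F], with [G s] as slope at [s]: integrate [expR y >= 1 + y] for
    [y = (r - s) * u x] against the tilted measure. *)
Lemma tilted_mass_tangent (s r : R) : (s < 0)%R -> (r < 0)%R ->
  (F s + (r - s) * G s <= F r)%R.
Proof.
move=> s0 r0.
have i1 := integrable_id_tilt s s0.
rewrite -RintegralZl// -RintegralD//; last 2 first.
- exact: int0.
- exact: (integrableZl mD (r - s)%R i1).
apply: le_Rintegral => //.
- exact: (integrableD mD (int0 s s0) (integrableZl mD (r - s)%R i1)).
- exact: int0.
move=> x _; have -> : (r * u x = s * u x + (r - s) * u x)%R by ring.
rewrite expRD mulrA -[X in (X + _)%R]mulr1 [X in (_ + X)%R]mulrC -mulrDr.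
by rewrite ler_wpM2l ?expR_ge0// expR_ge1Dx.
Qed.

(** The slope of [G] is the tilted integral of [u ^+ 2], and for parameters in [[a, b]] the tilt is
    at most the sum of those at [a] and [b]. Tangent inequalities under the integral replace
    differentiation. *)
Lemma tilted_mean_lipschitz (a b s r : R) :
  (a <= s)%R -> (s <= r)%R -> (r <= b)%R -> (b < 0)%R ->
  (G r - G s <= (r - s) * ((\int[mu]_(x in D) (u x ^+ 2 * expR (a * u x))) +
    (\int[mu]_(x in D) (u x ^+ 2 * expR (b * u x)))))%R.
Proof.
move=> as_ sr rb b0.
have r0 : (r < 0)%R by lra.
have s0 : (s < 0)%R by lra.
have a0 : (a < 0)%R by lra.
have ia := integrable_sqr_tilt a a0.
have ib := integrable_sqr_tilt b b0.
have ir := integrable_id_tilt r r0.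
have is_ := integrable_id_tilt s s0.
rewrite -RintegralD// -RintegralB// -RintegralZl//; last first.
  exact: (integrableD mD ia ib).
apply: le_Rintegral => //.
- exact: (integrableB mD ir is_).
- exact: (integrableZl mD (r - s)%R (integrableD mD ia ib)).
move=> x _.
have tan p q : (expR (p * u x) * (1 + (q - p) * u x) <= expR (q * u x))%R.
  have -> : (q * u x = p * u x + (q - p) * u x)%R by ring.
  by rewrite expRD ler_wpM2l ?expR_ge0// expR_ge1Dx.
have Ea := expR_ge0 (a * u x); have Eb := expR_ge0 (b * u x).
have u2 : (0 <= (r - s) * u x ^+ 2)%R by apply: mulr_ge0; rewrite ?subr_ge0 ?sqr_ge0.
(* For [u x >= 0] the tangent at [r] gives the bound and [b] dominates; for [u x < 0] the tangent at
   [s] does and [a] dominates. *)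
have [u0|u0] := leP 0%R (u x).
- have h := tan r s.
  have rb' : (expR (r * u x) <= expR (b * u x))%R by rewrite ler_expR; nra.
  have h1 : (u x * (expR (r * u x) - expR (s * u x)) <=
             (r - s) * u x ^+ 2 * expR (r * u x))%R.
    have := ler_wpM2l u0 h; nra.
  have h2 := ler_wpM2l u2 rb'.
  have h3 := mulr_ge0 u2 Ea.
  rewrite -mulrBr; apply: (le_trans h1); apply: (le_trans h2).
  by rewrite -mulrDr mulrA mulrDr lerDr.
- have h := tan s r.
  have sa' : (expR (s * u x) <= expR (a * u x))%R by rewrite ler_expR; nra.
  have h1 : (u x * (expR (r * u x) - expR (s * u x)) <=
             (r - s) * u x ^+ 2 * expR (s * u x))%R.
    have u0' : (0 <= - u x)%R by lra.
    have := ler_wpM2l u0' h; nra.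
  have h2 := ler_wpM2l u2 sa'.
  have h3 := mulr_ge0 u2 Eb.
  rewrite -mulrBr; apply: (le_trans h1); apply: (le_trans h2).
  by rewrite -mulrDr mulrA mulrDr lerDl.
Qed.

(** Linear growth gives [F s > F (-1)] far to the left, and the tangent at [s], evaluated at [-1],
    then has to descend. *)
Lemma tilted_mean_lt0 : exists2 s : R, (s < -1)%R & (G s < 0)%R.
Proof.
have k0 := fine_muA_gt0; set k := fine (mu A) in k0.
(* Chosen so that the linear lower bound for [F s] equals [|F (-1)| + 2 * k]. *)
pose s := (- (2 * `|F (-1)| / k + 2))%R.
have f0 : (0 <= 2 * `|F (-1)| / k)%R by rewrite divr_ge0 ?mulr_ge0// ltW.
exists s; first by rewrite /s; lra.
have s0 : (s < 0)%R by rewrite /s; lra.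
have := tilted_mass_tangent s (-1)%R s0 (ltrN10 R).
have := tilted_mass_ge s s0; rewrite -/k.
have -> : ((1 - s / 2) * k = `|F (-1)| + 2 * k)%R by rewrite /s; field; rewrite gt_eqF.
move=> h1 h2.
have h3 := ler_norm (F (-1)%R).
have : ((-1 - s) * G s < 0)%R by lra.
by rewrite pmulr_rlt0//; rewrite /s; lra.
Qed.

(* [G] is the derivative of [F].  If [G] is negative at some [b >= -e], take
   [s = b], since [G / F >= -1]; otherwise take [s] just before the first
   sign change of [G] on a fine grid; [G] being Lipschitz, it is small there. *)
Lemma tilting_parameter (e : R) : (0 < e)%R ->
  exists s : R, [/\ (s < 0)%R, (G s < 0)%R & (s * (G s / F s) <= e)%R].
Proof.
move=> e0; have k0 := fine_muA_gt0; set k := fine (mu A) in k0.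
have Fk s : (s < 0)%R -> (k <= F s)%R.
  move=> s0; apply: le_trans (tilted_mass_ge s s0); rewrite -/k.
  by rewrite ler_peMl// ?ltW//; lra.
have GF s : (s < 0)%R -> (- F s <= G s)%R.
  move=> s0; have i0 := int0 s s0; have i1 := integrable_id_tilt s s0.
  rewrite -subr_ge0 opprK -RintegralD//; apply: Rintegral_ge0 => x Dx.
  have ux := u_ge x Dx; have := expR_ge0 (s * u x); nra.
have [a a1 Ga] := tilted_mean_lt0.
pose b := (- Num.min e 1)%R.
have b0 : (b < 0)%R by rewrite /b oppr_lt0 lt_min e0 ltr01.
have be : (- b <= e)%R by rewrite /b opprK ge_min lexx.
have b1 : (-1 <= b)%R by rewrite /b lerN2 ge_min lexx orbT.
have ab : (a < b)%R by exact: lt_le_trans b1.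
clearbody b k.
have [Gb|Gb] := ltP (G b) 0%R.
  exists b; split=> //; apply: le_trans be.
  have Fb := tilted_mass_gt0 b b0.
  rewrite mulrA ler_pdivrMr//; have := GF b b0; nra.
set L := ((\int[mu]_(x in D) (u x ^+ 2 * expR (a * u x))) +
    (\int[mu]_(x in D) (u x ^+ 2 * expR (b * u x))))%R.
have L0 : (0 <= L)%R.
  by apply: addr_ge0; apply: Rintegral_ge0 => x _;
    apply: mulr_ge0; rewrite ?sqr_ge0 ?expR_ge0.
(* A grid of [N >= q] steps has mesh [h] with [h * L * (- a) <= k * e]. At the chosen grid point
   [- G] is at most [h * L], the parameter is at least [a], and [F >= k]. *)
pose q := ((b - a) * L * (- a) / (k * e))%R.
pose N := (Num.bound q).+1.
have N0 : (0 < N%:R :> R)%R by rewrite ltr0n.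
pose h := ((b - a) / N%:R)%R.
have h0 : (0 < h)%R by rewrite divr_gt0// subr_gt0.
pose p i := (a + i%:R * h)%R.
have pN : p N = b by rewrite /p /h; field; rewrite gt_eqF.
have exP : exists i, (0 <= G (p i))%R by exists N; rewrite pN.
case: (ex_minnP exP) => -[|i] Gi imin.
  by move: Gi; rewrite /p mul0r addr0 leNgt Ga.
have iN : (i < N)%N by apply: imin; rewrite pN.
have Gs : (G (p i) < 0)%R.
  by rewrite ltNge; apply/negP => /imin; rewrite ltnn.
have pS : p i.+1 = (p i + h)%R by rewrite /p -natr1; ring.
have ap : (a <= p i)%R by rewrite /p lerDl mulr_ge0// ltW.
have pb : (p i.+1 <= b)%R.
  by rewrite -pN /p lerD2l ler_wpM2r ?ler_nat// ltW.
have pp : (p i <= p i.+1)%R by rewrite pS lerDl ltW.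
have p0 : (p i < 0)%R by exact: le_lt_trans (le_trans pp pb) b0.
exists (p i); split=> //.
have := tilted_mean_lipschitz a b (p i) (p i.+1) ap pp pb b0.
rewrite -/L => lip.
have dp : (p i.+1 - p i = h)%R by rewrite pS addrAC subrr add0r.
have {lip}Gh : (- G (p i) <= h * L)%R.
  by rewrite dp in lip; apply: le_trans lip; rewrite -[leLHS]sub0r lerD2r.
have a0 : (a < 0)%R by exact: lt_trans b0.
have hL : (h * L * (- a) <= k * e)%R.
  have ke : (0 < k * e)%R by rewrite mulr_gt0.
  have -> : (h * L * - a = (b - a) * L * (- a) / N%:R)%R.
    by rewrite /h; field; rewrite gt_eqF.
  rewrite ler_pdivrMr// [leRHS]mulrC -ler_pdivrMr//.
  have q0 : (0 <= q)%R.
    by rewrite divr_ge0 ?(ltW ke)// !mulr_ge0 ?subr_ge0 ?oppr_ge0 ?(ltW a0) ?(ltW ab).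
  rewrite -/q; apply/ltW/(lt_le_trans (archi_boundP q0)).
  by rewrite ler_nat.
have Fp := tilted_mass_gt0 (p i) p0.
rewrite mulrA ler_pdivrMr//.
have kF := Fk (p i) p0.
apply: (@le_trans _ _ (k * e)%R); last by rewrite mulrC ler_wpM2l// ltW.
apply: le_trans hL.
by rewrite -mulrNN mulrC; apply: ler_pM; rewrite ?oppr_ge0 ?lerN2 ?(ltW Gs) ?(ltW p0).
Qed.

End tilted_moments.

(** * The logarithmic limit for a general recursion *)

Lemma cvg_log_sublevel_volume d (T : measurableType d) (R : realType)
    (mu : {measure set T -> \bar R}) (D A : set T) (u : T -> R)
    (v : nat -> R -> \bar R) :
  measurable D -> measurable_fun D u -> (forall x, D x -> (-1 <= u x)%R) ->
  (forall s : R, (s < 0)%R ->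
    mu.-integrable D (EFin \o (fun x => expR (s * u x))%R)) ->
  measurable A -> A `<=` D -> 0 < mu A -> mu A < +oo ->
  (forall x, A x -> (u x <= - 2^-1)%R) ->
  (forall t, v 0%N t = ((0 <= t)%R%:R : R)%:E) ->
  (forall n t, v n.+1 t = \int[mu]_(x in D) v n (t - u x)%R) ->
  (n%:R^-1)%:E * lne (v n 0%R) @[n --> \oo] -->
  - ereal_sup [set (- ln (\int[mu]_(x in D) expR (s * u x)))%R%:E
              | s in [set s : R | (s < 0)%R]].
Proof.
move=> mD mfu u_ge int0 mA AD A0 Aoo uA v0 vS.
set S := [set _ | _ in _].
pose F (s : R) := (\int[mu]_(x in D) expR (s * u x))%R.
have F0 s : (s < 0)%R -> (0 < F s)%R.
  by move=> s0; apply: (@tilted_mass_gt0 _ _ _ mu D A u).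
have k0 : (0 < fine (mu A))%R by rewrite fine_gt0// A0.
have Fk s : (s < 0)%R -> (fine (mu A) <= F s)%R.
  move=> s0; apply: le_trans (@tilted_mass_ge _ _ _ mu D A u _ _ _ _ _ _ s s0) => //.
  by rewrite ler_peMl// ?ltW//; lra.
(* The supremum is a real number [l]: [F >= mu A] bounds it above, and its term at [s = -1] bounds
   it below. *)
have S_ub : ereal_sup S <= (- ln (fine (mu A)))%:E.
  apply: ge_ereal_sup => _ [s s0 <-]; rewrite lee_fin lerN2.
  by rewrite ler_ln ?posrE ?Fk ?F0.
have S_lb : (- ln (F (-1)))%:E <= ereal_sup S.
  by apply: ereal_sup_ubound; exists (-1)%R => //=; rewrite ltrN10.
have [l Sl] : exists l : R, ereal_sup S = l%:E.
  by case: (ereal_sup S) S_ub S_lb => // r _ _; exists r.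
have lF s : (s < 0)%R -> (- l <= ln (F s))%R.
  move=> s0; rewrite lerNl -lee_fin -Sl; apply: ereal_sup_ubound.
  by exists s.
rewrite Sl.
(* In [3 * e], two parts pay for the window factor [expR (- 2 * n * s * m)] and one for the factor
   [1 / 2], once [ln 2 <= n * e]. *)
have main (e : R) : (0 < e)%R -> \forall n \near \oo,
    exists2 r, (n%:R^-1)%:E * lne (v n 0%R) = r%:E & (`|- l - r| <= 3 * e)%R.
  move=> e0.
  have [s [s0 Gs se]] := @tilting_parameter _ _ _ mu D A u mD mfu u_ge
    int0 mA AD A0 Aoo uA e e0.
  set G := (\int[mu]_(x in D) (u x * expR (s * u x)))%R in Gs se.
  rewrite -/(F s) in se; have Fs := F0 s s0.
  pose m := (G / F s)%R.
  have m0 : (m < 0)%R by rewrite ltr_pdivrMr// mul0r.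
  pose sg := ((\int[mu]_(x in D) (u x ^+ 2 * expR (s * u x))) / F s - m ^+ 2)%R.
  near=> n.
  have n0 : (0 < n%:R :> R)%R.
    rewrite ltr0n; near: n; exact: nbhs_infty_gt.
  have nsg : (2 * sg / m ^+ 2 <= n%:R)%R.
    near: n; exact: nbhs_infty_ger.
  have nln : (ln 2 / e <= n%:R)%R.
    near: n; exact: nbhs_infty_ger.
  (* At [t = 0] this centres the window [[- 2 * c, 0]] at the tilted mean [n * m], so only the
     variance term remains; it is at most [1 / 2] by [nsg]. *)
  pose c := (- (n%:R * m))%R.
  have c0 : (0 < c)%R by rewrite /c -mulrN mulr_gt0// oppr_gt0.
  have lb := @chebyshev_lower_bound _ _ _ mu D u mD v v0 vS s c m sg n 0 s0 c0
    (int0 s s0) (integrable_id_tilt _ _ _ mu D u mD mfu u_ge int0 s s0)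
    (integrable_sqr_tilt _ _ _ mu D u mD mfu u_ge int0 s s0).
  rewrite -/(F s) -/G in lb.
  have {}lb : (F s ^+ n * expR (- 2 * (n%:R * (s * m))) / 2)%:E <= v n 0%R.
    apply: le_trans (lb _ _); last 2 first.
    - by rewrite /m; field; rewrite gt_eqF.
    - by rewrite /sg /m; field; rewrite gt_eqF.
    rewrite lee_fin /c sub0r.
    have -> : (- s * - (2 * - (n%:R * m)) = - 2 * (n%:R * (s * m)))%R by ring.
    apply: ler_wpM2l; first by rewrite mulr_ge0 ?exprn_ge0 ?expR_ge0// ltW.
    rewrite subr0 subrr expr0n/= addr0 sqrrN exprMn.
    have -> : (sg * n%:R / (n%:R ^+ 2 * m ^+ 2) = (2 * sg / m ^+ 2) / n%:R / 2)%R.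
      by field; rewrite gt_eqF// lt_eqF.
    suff : (2 * sg / m ^+ 2 / n%:R <= 1)%R by lra.
    by rewrite ler_pdivrMr// mul1r.
  have ub r : (r < 0)%R -> v n 0%R <= (F r ^+ n)%:E.
    move=> r0.
    have := @chernoff_upper_bound _ _ _ mu D u mD v v0 vS r n 0 (ltW r0) (int0 r r0).
    by rewrite mulr0 expR0 mul1r.
  have lb0 : (0 < F s ^+ n * expR (- 2 * (n%:R * (s * m))) / 2)%R.
    by rewrite divr_gt0// mulr_gt0 ?exprn_gt0 ?expR_gt0.
  have [w vw] : exists w : R, v n 0%R = w%:E.
    by case: (v n 0%R) lb (ub s s0) => // r _ _; exists r.
  rewrite vw !lee_fin in lb.
  have w0 : (0 < w)%R by exact: lt_le_trans lb.
  exists (n%:R^-1 * ln w)%R; first by rewrite vw lne_EFin.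
  have up : (n%:R^-1 * ln w <= - l)%R.
    rewrite lerNr -lee_fin -Sl; apply: ge_ereal_sup => _ [r r0 <-].
    rewrite lee_fin lerN2 mulrC ler_pdivrMr// -/(F r).
    have := ub r r0; rewrite vw lee_fin => h.
    have Fr := F0 r r0.
    rewrite mulr_natr -lnXn// ler_ln ?posrE// exprn_gt0//.
  have low : (ln (F s) - 3 * e <= n%:R^-1 * ln w)%R.
    have : (ln (F s ^+ n * expR (- 2 * (n%:R * (s * m))) / 2) <= ln w)%R.
      by rewrite ler_ln ?posrE.
    rewrite ln_div ?posrE ?mulr_gt0 ?exprn_gt0 ?expR_gt0//.
    rewrite lnM ?posrE ?exprn_gt0 ?expR_gt0// lnXn// expRK => h.
    rewrite [leRHS]mulrC ler_pdivlMr//.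
    rewrite ler_pdivrMr// in nln.
    rewrite -/m in se.
    have := ler_wpM2r (ltW n0) se.
    rewrite -[(ln (F s) *+ n)%R]mulr_natr in h.
    set x1 := (_ * n%:R)%R; set x2 := (s * m)%R; nra.
  have lFs := lF s s0.
  by rewrite ger0_norm; lra.
apply/fine_cvgP; split.
  by apply: filterS (main 1%R ltr01) => n [r E _] /=; rewrite E.
apply/cvgrPdist_le => e e0.
have e30 : (0 < e / 3)%R by rewrite divr_gt0.
apply: filterS (main _ e30) => n [r E h] /=.
by rewrite E; apply: (le_trans h); lra.
Unshelve. all: by end_near.
Qed.

(** * Orlicz functions on the line: measurability, growth and behaviour near 0 *)

Section orlicz.
Context (R : realType) (V : R -> \bar R).
Hypothesis hV : orlicz_function V.

Local Notation D := (orlicz_domain V).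
Local Notation mu := (@lebesgue_measure R).
Local Notation u := (fun x => fine (V x) - 1)%R.

Lemma orlicz_ge0 x : 0 <= V x. Proof. by case: hV. Qed.

Lemma orlicz0 : V 0%R = 0. Proof. by case: hV. Qed.

Lemma orlicz_norm x : V `|x|%R = V x.
Proof.
case: hV => _ _ VN _.
by have [x0|x0] := leP 0%R x; [rewrite ger0_norm|rewrite ltr0_norm].
Qed.

Lemma fine_orliczK x : D x -> (fine (V x))%:E = V x.
Proof. by move=> Dx; rewrite fineK// ge0_fin_numE ?orlicz_ge0. Qed.

Lemma orlicz_scale (t x : R) : (0 <= t <= 1)%R -> V (t * x)%R <= t%:E * V x.
Proof.
case: hV => _ _ _ cV t01.
by have := cV x 0%R t t01; rewrite mulr0 addr0 orlicz0 mule0 adde0.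
Qed.

(** This is convexity; intervals being Borel, it yields the measurability of [V] and of its
    domain. *)
Lemma is_interval_orlicz_sublevel (y : \bar R) :
  is_interval [set x | V x < y].
Proof.
move=> a b /= Va Vb z /andP[az zb].
have [ab|ab] := eqVneq a b.
  by have -> : z = a by apply/eqP; rewrite eq_le az ab zb.
have ltab : (a < b)%R by rewrite lt_neqAle ab (le_trans az zb).
pose t := ((b - z) / (b - a))%R.
have t01 : (0 <= t <= 1)%R.
  rewrite /t; apply/andP; split.
    by rewrite divr_ge0 ?subr_ge0 ?(ltW ltab).
    by rewrite ler_pdivrMr ?subr_gt0//; lra.
have -> : (z = t * a + (1 - t) * b)%R.
  by rewrite /t; field; rewrite subr_eq0 eq_sym.
case: hV => _ _ _ /(_ a b t t01) /le_lt_trans; apply.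
have Da : D a by exact: (lt_le_trans Va (leey _)).
have Db : D b by exact: (lt_le_trans Vb (leey _)).
move: Va Vb; rewrite -(fine_orliczK _ Da) -(fine_orliczK _ Db).
move: y => [y| |].
- rewrite -!EFinM -EFinD !lte_fin; move/andP: t01 => [t0 t1] Va Vb.
  by have [h|h] := leP (fine (V a)) (fine (V b)); nra.
- by move=> _ _; rewrite -!EFinM -EFinD ltry.
- by rewrite ltNge leNye.
Qed.

Lemma measurable_orlicz : measurable_fun [set: R] V.
Proof.
apply: (measurability _ (ErealGenInftyO.measurableE R)) => // _ /= [_ [r ->] <-].
rewrite setTI; apply: is_interval_measurable.
have -> : V @^-1` `]-oo, r%:E[%classic = [set x | V x < r%:E].
  by apply/seteqP; split => x /=; rewrite in_itv.
exact: is_interval_orlicz_sublevel.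
Qed.

Lemma measurable_orlicz_domain : measurable D.
Proof. exact: (is_interval_measurable (is_interval_orlicz_sublevel +oo)). Qed.

Lemma measurable_orlicz_sub1 : measurable_fun D u.
Proof.
apply: measurable_funB => //.
apply: measurable_funTS; apply: measurableT_comp; last exact: measurable_orlicz.
exact: fine_measurable.
Qed.

Lemma orlicz_sub1_ge x : D x -> (-1 <= u x)%R.
Proof. by move=> _; rewrite lerBrDr addNr fine_ge0// orlicz_ge0. Qed.

(** Symmetry reduces to the half-line, where the integrand is [(- k)^-1] times the exponential
    density of parameter [- k]. *)
Lemma integrable_expR_norm (k : R) : (k < 0)%R ->
  mu.-integrable [set: R] (EFin \o (fun x => expR (k * `|x|))%R).
Proof.
move=> k0.
have cf : continuous (fun x : R => expR (k * `|x|))%R.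
  move=> x; apply: (@continuous_comp _ _ _ (fun x : R => k * `|x|)%R expR).
    by apply: continuousM; [exact: cst_continuous|exact: norm_continuous].
  exact: continuous_expR.
apply/integrableP; split.
  by apply/measurable_EFinP; exact: continuous_measurable_fun.
have -> : \int[mu]_x `|(EFin \o (fun x => expR (k * `|x|))%R) x| =
    \int[mu]_x (expR (k * `|x|))%:E.
  by apply: eq_integral => x _ /=; rewrite ger0_norm// expR_ge0.
have f0 (x : R) : (0 <= expR (k * `|x|))%R by exact: expR_ge0.
have fN : (fun x : R => expR (k * `|x|))%R =1
    (fun x : R => expR (k * `|x|))%R \o -%R by move=> x /=; rewrite normrN.
rewrite (ge0_symfun_integralT f0 cf fN).
rewrite lte_mul_pinfty// integral_mkcond.
apply: (@le_lt_trans _ _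
    (\int[mu]_x ((- k)^-1%:E * (exponential_pdf (- k) x)%:E))).
  apply: le_integral_nonmeasurable => x _; rewrite patchE.
  have [x0|x0] := leP 0%R x; last first.
    rewrite memNset/=; last by apply/negP; rewrite -ltNge.
    by rewrite -EFinM lee_fin mulr_ge0 ?exponential_pdf_ge0// ?invr_ge0 oppr_ge0 ltW.
  rewrite mem_set// exponential_pdfE//.
  rewrite ger0_norm// -EFinM lee_fin opprK mulrA mulVf ?mul1r//.
  by rewrite oppr_eq0 lt_eqF.
rewrite integralZl ?integral_exponential_pdf ?oppr_gt0//.
- by rewrite mule1 ltry.
- by apply: integrable_exponential_pdf; rewrite oppr_gt0.
Qed.

(** A convex function vanishing at 0 and positive at [x1] grows at least linearly in [|x|], so the
    tilt is dominated by a multiple of some [expR (k * |x|)] with [k < 0]. *)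
Lemma integrable_expR_orlicz (x1 s : R) : 0 < V x1 -> (s < 0)%R ->
  mu.-integrable D (EFin \o (fun x => expR (s * u x))%R).
Proof.
move=> Vx1 s0.
pose z := `|x1|%R.
have z0 : (0 < z)%R.
  rewrite normr_gt0; apply/eqP => x10.
  by rewrite x10 orlicz0 ltxx in Vx1.
(* [V z] may be [+oo]; a positive real lower bound is enough. *)
have [p p0 pV] : exists2 p : R, (0 < p)%R & p%:E <= V z.
  rewrite /z orlicz_norm; case: (V x1) Vx1 => [r| |]// r0; first by exists r.
  by exists 1%R => //; rewrite leey.
have grow x : D x -> (p / z * `|x| - p <= fine (V x))%R.
  move=> Dx; have [xz|xz] := leP z `|x|%R; last first.
    apply: (@le_trans _ _ 0%R); last by rewrite fine_ge0// orlicz_ge0.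
    by rewrite subr_le0 mulrAC ler_pdivrMr// ler_wpM2l// ltW.
  have x0 : (0 < `|x|)%R by exact: lt_le_trans xz.
  have t01 : (0 <= z / `|x| <= 1)%R.
    by rewrite divr_ge0 ?(ltW z0)//= ler_pdivrMr// mul1r.
  have := orlicz_scale (z / `|x|)%R `|x|%R t01.
  rewrite divfK ?gt_eqF// (orlicz_norm x) -(fine_orliczK _ Dx) -EFinM.
  move=> /(le_trans pV); rewrite lee_fin mulrAC ler_pdivlMr// => h.
  rewrite lerBlDr mulrAC ler_pdivrMr//.
  have := mulr_gt0 p0 z0; nra.
have mD := measurable_orlicz_domain.
pose k := (s * (p / z))%R.
have k0 : (k < 0)%R by rewrite /k nmulr_rlt0// divr_gt0.
have intk : mu.-integrable D (EFin \o (fun x => expR (k * `|x|))%R).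
  have h := @integrableS _ _ R mu setT D
    (EFin \o (fun x => expR (k * `|x|))%R) measurableT mD.
  by apply: h => //; exact: (integrable_expR_norm k k0).
apply: (@le_integrable _ _ R mu D mD _
  (fun x => (expR (- s * (p + 1)))%:E * (EFin \o (fun x => expR (k * `|x|))%R) x)).
- apply/measurable_EFinP; apply: measurableT_comp => //.
  by apply: measurable_funM => //; exact: measurable_orlicz_sub1.
- move=> x Dx /=; rewrite lee_fin [leLHS]ger0_norm ?expR_ge0//.
  rewrite [leRHS]ger0_norm ?mulr_ge0 ?expR_ge0//.
  rewrite -expRD ler_expR.
  have h : (s * (fine (V x) - (p / z * `|x| - p)) <= 0)%R.
    by rewrite nmulr_rle0// subr_ge0 grow.
  by rewrite -subr_le0 (le_trans _ h)// le_eqVlt /k; apply/orP; left; apply/eqP; ring.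
- exact: integrableZl.
Qed.

(** Convexity gives [V (t * x0) <= t * V x0], hence [V <= 1 / 2] near 0. The interval will be the
    set [A] of the general limit. *)
Lemma orlicz_small_itv (x0 : R) : x0 != 0%R -> V x0 < +oo ->
  exists2 a : R, (0 < a)%R & forall x, `[(- a)%R, a]%classic x ->
    D x /\ (u x <= - 2^-1)%R.
Proof.
move=> x00 Dx0.
pose z := `|x0|%R.
have z0 : (0 < z)%R by rewrite normr_gt0.
pose r := fine (V x0).
have r0 : (0 <= r)%R by rewrite fine_ge0// orlicz_ge0.
(* The [+ 1] covers [r = 0] and ensures [t <= 1] together with [t * r <= 1 / 2]. *)
pose t := (2 * (r + 1))^-1%R.
have t0 : (0 < t)%R by rewrite invr_gt0; lra.
have tr : (t * r <= 2^-1)%R.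
  by rewrite /t mulrC ler_pdivrMr; lra.
have t1 : (t <= 1)%R by rewrite /t invf_le1; lra.
exists (t * z)%R; first exact: mulr_gt0.
move=> x /=; rewrite in_itv/= -ler_norml => xa.
have xz : (`|x| / z <= t)%R by rewrite ler_pdivrMr.
have Vx : V x <= (2^-1)%R%:E.
  rewrite -orlicz_norm.
  have -> : (`|x| = `|x| / z * z)%R by rewrite divfK// gt_eqF.
  apply: le_trans (orlicz_scale _ _ _) _.
    by rewrite divr_ge0 ?(ltW z0)//= (le_trans xz).
  rewrite orlicz_norm -(fine_orliczK _ Dx0) -EFinM lee_fin -/r.
  by apply: le_trans tr; rewrite ler_wpM2r.
have Dx : D x by exact: (le_lt_trans Vx (ltry _)).
by split => //; move: Vx; rewrite -(fine_orliczK _ Dx) lee_fin; lra.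
Qed.

(** * Volumes of balls and their recursion in the dimension *)

Definition orlicz_volume (n : nat) (t : R) : \bar R :=
  lebesgue_tuple [set x : n.-tuple R |
    \sum_(i < n) V (tnth x i) <= (n%:R + t)%:E].

(** [lebesgue_tuple] is handled as a bare set function, so this value is computed through sections,
    by induction. *)
Lemma lebesgue_tuple_set0 n : @lebesgue_tuple R n set0 = 0.
Proof.
elim: n => [|n IH]; first by rewrite /= /dirac indicE in_set0.
rewrite /= /pushforward preimage_set0 /product_measure1.
by apply: integral0_eq => x _ /=; rewrite xsection0 IH.
Qed.

Lemma orlicz_volume0 t : orlicz_volume 0 t = ((0 <= t)%R%:R : R)%:E.
Proof.
rewrite /orlicz_volume /= /dirac indicE; congr ((nat_of_bool _)%:R%:E).
by apply/idP/idP; rewrite inE /= big_ord0 add0r lee_fin.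
Qed.

(** For [x] in [D] the section of the sublevel set is a sublevel set with [t - u x], the [- 1] in
    [u] absorbing the passage from [n.+1] to [n]; for other [x] the section is empty. *)
Lemma orlicz_volumeS n t :
  orlicz_volume n.+1 t = \int[mu]_(x in D) orlicz_volume n (t - u x)%R.
Proof.
rewrite [RHS]integral_mkcond /orlicz_volume [LHS]/= /pushforward /product_measure1.
apply: eq_integral => x _ /=; rewrite patchE.
have sumS (y : n.-tuple R) : \sum_(i < n.+1) V (tnth [tuple of x :: y] i) =
    V x + \sum_(i < n) V (tnth y i).
  by rewrite big_ord_recl; congr (_ + _); apply: eq_bigr => i _; rewrite tnthS.
case: ifPn => [/set_mem Dx|/negP Dx].
  have E (y : n.-tuple R) :
      (\sum_(i < n.+1) V (tnth [tuple of x :: y] i) <= (n.+1%:R + t)%:E) =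
      (\sum_(i < n) V (tnth y i) <= (n%:R + (t - (fine (V x) - 1)))%:E).
    rewrite sumS -(fine_orliczK _ Dx) -leeBrDl// -EFinB -natr1.
    by congr (_ <= _%:E); ring.
  by congr lebesgue_tuple; apply/seteqP; split=> y; rewrite /xsection/= inE/= E.
transitivity (@lebesgue_tuple R n set0); last exact: lebesgue_tuple_set0.
congr lebesgue_tuple.
apply/seteqP; split => // y; rewrite /xsection/= inE/= sumS => h; apply: Dx.
apply: mem_set; apply: le_lt_trans (ltry _); apply: le_trans h.
by rewrite leeDl// sume_ge0// => i _; exact: orlicz_ge0.
Qed.

Lemma orlicz_volume_ball n : orlicz_volume n 0 = lebesgue_tuple (orlicz_ball V n).
Proof. by rewrite /orlicz_volume /orlicz_ball addr0. Qed.

End orlicz.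

(** * The rate function and the two degenerate cases *)

Lemma orlicz_rate_nondegenerate (R : realType) (V : R -> \bar R) (s : R) :
  let D := orlicz_domain V in let mu := @lebesgue_measure R in
  let F := (\int[mu]_(x in D) expR (s * (fine (V x) - 1)))%R in
  orlicz_function V ->
  mu.-integrable D (EFin \o (fun x => expR (s * (fine (V x) - 1)))%R) ->
  (0 < F)%R ->
  s%:E - lne (\int[mu]_(x in D) expeR (s%:E * V x)) = (- ln F)%:E.
Proof.
move=> D mu F hV iF F0.
(* On [D], [V] is [u + 1]; the resulting factor [expR s] cancels the leading [s]. *)
have -> : \int[mu]_(x in D) expeR (s%:E * V x) = (expR s * F)%:E.
  transitivity (\int[mu]_(x in D) ((expR s)%:E *
      (expR (s * (fine (V x) - 1)))%:E)).
    apply: eq_integral => x /set_mem Dx.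
    rewrite -(fine_orliczK _ V hV x Dx) -!EFinM/= -expRD.
    by congr (expR _)%:E; ring.
  have mD := measurable_orlicz_domain _ V hV.
  rewrite (@integralZl _ _ R lebesgue_measure D mD _ iF) EFinM.
  congr (_ * _).
  by rewrite fineK// integrable_fin_num//; exact: measurable_orlicz_domain.
rewrite lne_EFin ?mulr_gt0 ?expR_gt0// lnM ?posrE ?expR_gt0// expRK -EFinB.
by congr (_%:E); ring.
Qed.

(** The domain is a null set: volumes and integrals vanish, and both sides are [-oo]. *)
Lemma cvg_orlicz_volume_null (R : realType) (V : R -> \bar R) :
  orlicz_function V -> (forall x, x != 0%R -> V x = +oo) ->
  (n%:R^-1)%:E * lne (lebesgue_tuple (orlicz_ball V n)) @[n --> \oo] -->
  - ereal_sup [set s%:E - lne (\int[lebesgue_measure]_(x in orlicz_domain V)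
                                  expeR (s%:E * V x))
              | s in [set s : R | (s < 0)%R]].
Proof.
move=> hV Voo.
have D1 : orlicz_domain V `<=` [set 0%R].
  move=> x Dx; apply/eqP; rewrite -[_ == _]negbK; apply/negP => x0.
  by move: Dx; rewrite /orlicz_domain/= (Voo x x0) ltxx.
have -> : ereal_sup [set s%:E - lne (\int[lebesgue_measure]_(x in orlicz_domain V)
                                  expeR (s%:E * V x))
              | s in [set s : R | (s < 0)%R]] = +oo.
  apply/eqP; rewrite -leye_eq; apply: ereal_sup_ubound; exists (-1)%R => /=.
    exact: ltrN10.
  by rewrite (integral_Sset1 0%R D1) le0_lneNy.
apply: cvg_near_cst; near=> n.
(* In dimension 0 the ball has mass 1, so the sequence is constant only from [n = 1] on. *)
have n0 : (0 < n)%N by near: n; exact: nbhs_infty_gt.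
rewrite -(prednK n0) -orlicz_volume_ball.
rewrite orlicz_volumeS// (integral_Sset1 0%R D1) le0_lneNy//.
by rewrite gt0_muleNy// lte_fin invr_gt0.
Unshelve. all: by end_near.
Qed.

(** The ball is the whole space: volumes (for [n > 0]) and integrals are infinite, and both sides
    are [+oo]. *)
Lemma cvg_orlicz_volume_zero (R : realType) (V : R -> \bar R) :
  orlicz_function V -> (forall x, V x = 0) ->
  (n%:R^-1)%:E * lne (lebesgue_tuple (orlicz_ball V n)) @[n --> \oo] -->
  - ereal_sup [set s%:E - lne (\int[lebesgue_measure]_(x in orlicz_domain V)
                                  expeR (s%:E * V x))
              | s in [set s : R | (s < 0)%R]].
Proof.
move=> hV V0.
have DT : orlicz_domain V = [set: R].
  by apply/seteqP; split => // x _; rewrite /orlicz_domain/= V0.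
have intoo : \int[@lebesgue_measure R]_(x in [set: R]) (1 : \bar R) = +oo.
  have := @lebesgue_measure_itv R (Interval -oo%O +oo%O).
  by rewrite integral_cst// mul1e /= set_itvNyy.
have -> : ereal_sup [set s%:E - lne (\int[lebesgue_measure]_(x in orlicz_domain V)
                                  expeR (s%:E * V x))
              | s in [set s : R | (s < 0)%R]] = -oo.
  apply/eqP; rewrite -leeNy_eq; apply: ge_ereal_sup => _ [s s0 <-].
  rewrite DT (_ : \int[_]_(x in _) _ = +oo) //.
  rewrite -intoo; apply: eq_integral => x _.
  by rewrite V0 mule0 expeR0.
(* The bound 1 also holds in dimension 0, and integrating it over the line already gives [+oo]. *)
have vol_ge1 n t : (- n%:R <= t)%R -> 1 <= orlicz_volume R V n t.
  elim: n t => [|n IH] t nt.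
    by rewrite orlicz_volume0 -[X in (X <= _)%R]oppr0 nt.
  rewrite orlicz_volumeS// DT.
  apply: (@le_trans _ _ (\int[@lebesgue_measure R]_(x in [set: R]) (1 : \bar R))).
    by rewrite intoo leey.
  apply: le_integral_nonmeasurable => x _; apply: IH.
  by rewrite V0/= sub0r opprK -lerBlDr -opprD natr1.
apply: cvg_near_cst; near=> n.
have n0 : (0 < n)%N by near: n; exact: nbhs_infty_gt.
rewrite -(prednK n0) -orlicz_volume_ball.
have -> : orlicz_volume R V n.-1.+1 0 = +oo.
  apply/eqP; rewrite -leye_eq orlicz_volumeS// DT -intoo.
  apply: le_integral_nonmeasurable => x _; apply: vol_ge1.
  by rewrite V0/= !sub0r opprK (@le_trans _ _ 0%R)// oppr_le0.
by rewrite gt0_muley// lte_fin invr_gt0.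
Unshelve. all: by end_near.
Qed.

Theorem mainTheorem13 (R : realType) (V : R -> \bar R)
    (hV : orlicz_function V) :
  (n%:R^-1)%:E * lne (lebesgue_tuple (orlicz_ball V n)) @[n --> \oo] -->
  - ereal_sup [set s%:E - lne (\int[lebesgue_measure]_(x in orlicz_domain V)
                                  expeR (s%:E * V x))
              | s in [set s : R | (s < 0)%R]].
Proof.
have [Voo|] := pselect (forall x, x != 0%R -> V x = +oo).
  exact: cvg_orlicz_volume_null.
move=> /existsNP[x0 /not_implyP[x00 /eqP]]; rewrite -ltey => Dx0.
have [V0|] := pselect (forall x, V x = 0).
  exact: cvg_orlicz_volume_zero.
move=> /existsNP[x1 /eqP Vx1].
have {}Vx1 : 0 < V x1 by rewrite lt0e Vx1 orlicz_ge0.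
set D := orlicz_domain V; set mu := @lebesgue_measure R.
(* The point [x1], where [V] is positive, provides integrability; [x0], a nonzero point of the
   domain, provides the interval on which [u <= - 1 / 2]. *)
have int0 s (s0 : (s < 0)%R) := @integrable_expR_orlicz R V hV x1 s Vx1 s0.
have [a a0 aV] := @orlicz_small_itv R V hV x0 x00 Dx0.
have muA : mu `[(- a)%R, a]%classic = (2 * a)%:E.
  rewrite /mu lebesgue_measure_itv/= lte_fin gt0_cp//.
  by rewrite -EFinB opprK mulr_natl mulr2n.
have AD : `[(- a)%R, a]%classic `<=` D by move=> x /aV[].
have uA x : `[(- a)%R, a]%classic x -> (fine (V x) - 1 <= - 2^-1)%R.
  by move=> /aV[].
have A0 : 0 < mu `[(- a)%R, a]%classic by rewrite muA lte_fin mulr_gt0.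
have Aoo : mu `[(- a)%R, a]%classic < +oo by rewrite muA ltry.
have mA : measurable `[(- a)%R, a]%classic by exact: measurable_itv.
have mD := measurable_orlicz_domain R V hV.
have mfu := measurable_orlicz_sub1 R V hV.
have := @cvg_log_sublevel_volume _ _ R mu D _ _ (orlicz_volume R V) mD mfu
  (orlicz_sub1_ge R V hV) int0 mA AD A0 Aoo uA (orlicz_volume0 R V)
  (orlicz_volumeS R V hV).
have -> : [set (- ln (\int[mu]_(x in D) expR (s * (fine (V x) - 1))))%R%:E
            | s in [set s : R | (s < 0)%R]] =
    [set s%:E - lne (\int[mu]_(x in D) expeR (s%:E * V x))
            | s in [set s : R | (s < 0)%R]].
  apply: eq_imagel => s s0; rewrite orlicz_rate_nondegenerate//; first exact: int0.
  exact: (@tilted_mass_gt0 _ _ _ mu D _ _ mD int0 mA AD A0 Aoo uA).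
by under eq_cvg do rewrite orlicz_volume_ball.
Qed.
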